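(* Let $n \geq 3$ and let $K_n$ be the complete graph on vertices $v_1,\dots,v_n$. Let $Q$ be any minimum 3-covering set of $K_n$. Then the minimum 3-covering energy of $K_n$ with respect to $Q$ is $$E_Q(K_n) = 1 + \sqrt{n^2 + 2n - 7}.$$
   Context: All graphs are finite, simple and undirected. For a graph $G$ with vertex set $\{v_1,\dots,v_n\}$, a 3-covering of $G$ is a set $Q$ of vertices such that every path in $G$ on 3 vertices (i.e. of length 2) contains at least one vertex of $Q$; a minimum 3-covering is a 3-covering of minimum cardinality. Given a minimum 3-covering $Q$, the minimum 3-covering matrix is the $n\times n$ matrix $A_Q^3(G)=(a_{ij})$ with $a_{ij}=1$ if $v_iv_j$ is an edge of $G$, $a_{ii}=1$ if $v_i\in Q$, and $a_{ij}=0$ otherwise. The minimum 3-covering energy is $E_Q(G)=\sum_{i=1}^n |\lambda_i|$, where $\lambda_1,\dots,\lambda_n$ are the (real) eigenvalues of $A_Q^3(G)$, i.e. the roots of $\det(\lambda I - A_Q^3(G))$. *)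

(* Defs.v *)
From HB Require Import structures.
From mathcomp Require Import all_boot all_order all_algebra.
From mathcomp Require Import complex polyrcf.

Set Implicit Arguments.
Unset Strict Implicit.
Unset Printing Implicit Defensive.

Import Order.TTheory GRing.Theory Num.Theory.
Local Open Scope ring_scope.

Record sgraph (n : nat) := SGraph {
  adj : rel 'I_n;
  adj_sym : symmetric adj;
  adj_irr : irreflexive adj
}.

Definition complete_adj (n : nat) : rel 'I_n := fun i j => i != j.

Lemma complete_adj_sym (n : nat) : symmetric (@complete_adj n).
Proof. by move=> i j; rewrite /complete_adj eq_sym. Qed.

Lemma complete_adj_irr (n : nat) : irreflexive (@complete_adj n).
Proof. by move=> i; rewrite /complete_adj eqxx. Qed.

Definition complete_graph (n : nat) : sgraph n :=
  SGraph (@complete_adj_sym n) (@complete_adj_irr n).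

Definition path3 (n : nat) (G : sgraph n) (u v w : 'I_n) : bool :=
  [&& uniq [:: u; v; w], adj G u v & adj G v w].

Definition covering3 (n : nat) (G : sgraph n) (Q : {set 'I_n}) : Prop :=
  forall u v w : 'I_n, path3 G u v w -> [|| u \in Q, v \in Q | w \in Q].

Definition min_covering3 (n : nat) (G : sgraph n) (Q : {set 'I_n}) : Prop :=
  covering3 G Q /\
  forall Q' : {set 'I_n}, covering3 G Q' -> (#|Q| <= #|Q'|)%N.

Definition covering3_mx (R : rcfType) (n : nat) (G : sgraph n)
    (Q : {set 'I_n}) : 'M[R]_n :=
  \matrix_(i < n, j < n) (adj G i j || (i == j) && (i \in Q))%:R.

(* [rootsR p] lists the distinct roots of [p] in [R]; each one is repeated
   according to its multiplicity. For a symmetric matrix this is the whole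
   spectrum, see [char_poly_eigenvalues]. *)
Definition eigenvalues (R : rcfType) (n : nat) (A : 'M[R]_n) : seq R :=
  flatten [seq nseq (mup x (char_poly A)) x | x <- rootsR (char_poly A)].

Definition covering3_energy (R : rcfType) (n : nat) (G : sgraph n)
    (Q : {set 'I_n}) : R :=
  \sum_(x <- eigenvalues (covering3_mx R G Q)) `|x|.

Lemma covering3_mx_sym (R : rcfType) (n : nat) (G : sgraph n)
    (Q : {set 'I_n}) : (covering3_mx R G Q)^T = covering3_mx R G Q.
Proof.
apply/matrixP => i j; rewrite !mxE adj_sym eq_sym.
by case: eqP => [->|].
Qed.

Lemma symmetric_char_poly_split (R : rcfType) (n : nat) (A : 'M[R]_n) :
  A^T = A -> exists s : seq R, char_poly A = \prod_(x <- s) ('X - x%:P).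
Proof.
move=> symA; pose f := real_complex R; pose B := map_mx f A.
have Bherm : B \is hermsymmx.
  apply/is_hermitianmxP; rewrite expr0 scale1r.
  apply/matrixP => i j; rewrite !mxE -{1}symA mxE.
  by apply/esym/CrealP; apply/complex_realP; exists (A j i).
have /orthomx_spectralP BE := hermitian_normalmx Bherm.
have dreal := hermitian_spectral_diag_real Bherm.
have Pu := spectral_unit B.
move: (spectralmx B) (spectral_diag B) BE dreal Pu => P d BE dreal Pu.
have cB : char_poly B = \prod_i ('X - (d 0 i)%:P).
  rewrite BE; set D := diag_mx d.
  have -> : char_poly (invmx P *m D *m P) = char_poly D.
    have gPV : map_mx polyC (invmx P) *m map_mx polyC P = 1%:M.
      by rewrite -map_mxM mulVmx // map_mx1.
    rewrite /char_poly.
    have -> : char_poly_mx (invmx P *m D *m P)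
        = map_mx polyC (invmx P) *m char_poly_mx D *m map_mx polyC P.
      rewrite /char_poly_mx mulmxBr mulmxBl !map_mxM.
      by rewrite scalar_mxC -['X%:M *m _ *m _]mulmxA gPV mulmx1.
    by rewrite !det_mulmx mulrAC -det_mulmx gPV det1 mul1r.
  rewrite char_poly_trig ?diag_mx_is_trig //.
  by apply: eq_bigr => i _; rewrite mxE eqxx mulr1n.
exists [seq complex.Re (d 0 i) | i <- enum 'I_n].
apply: (@map_poly_inj _ _ f).
rewrite map_char_poly -/B cB rmorph_prod big_map big_enum /=.
apply: eq_bigr => i _; rewrite rmorphB /= map_polyX map_polyC /=.
by congr ('X - _%:P); rewrite /f RRe_real //; move/mxOverP: dreal; apply.
Qed.

Lemma perm_eigenvalues (R : rcfType) (n : nat) (A : 'M[R]_n) (s : seq R) :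
  char_poly A = \prod_(x <- s) ('X - x%:P) -> perm_eq s (eigenvalues A).
Proof.
move=> cA; apply/allP => x _ /=; apply/eqP.
have p0 : char_poly A != 0 by rewrite monic_neq0 // char_poly_monic.
rewrite /eigenvalues count_flatten -!map_comp sumnE big_map.
transitivity (\sum_(y <- rootsR (char_poly A) | y == x)
                 mup y (char_poly A))%N; last first.
  rewrite big_mkcond; apply: eq_bigr => y _ /=; rewrite count_nseq /=.
  by case: eqP => _; rewrite ?mul1n ?mul0n.
have [xr | xNr] := boolP (x \in rootsR (char_poly A)).
  rewrite -big_filter filter_pred1_uniq ?uniq_roots // big_seq1.
  by rewrite cA mu_prod_XsubC.
rewrite big_seq_cond big1 => [|y /andP[yr /eqP yx]]; last first.
  by rewrite -yx yr in xNr.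
rewrite -mu_prod_XsubC -cA mupNroot //.
by apply: contra xNr => rx; rewrite -(roots_on_rootsR p0) in_itv.
Qed.

Lemma char_poly_eigenvalues (R : rcfType) (n : nat) (A : 'M[R]_n) :
  A^T = A -> char_poly A = \prod_(x <- eigenvalues A) ('X - x%:P).
Proof.
move=> /symmetric_char_poly_split[s cA].
by rewrite -(perm_big _ (perm_eigenvalues cA)).
Qed.

Lemma size_eigenvalues (R : rcfType) (n : nat) (A : 'M[R]_n) :
  A^T = A -> size (eigenvalues A) = n.
Proof.
move=> /char_poly_eigenvalues cA.
by have := size_char_poly A; rewrite cA size_prod_XsubC => -[].
Qed.

(* Main.v *)
(** A covering of [K_n] is minimum exactly when it misses two vertices, so
    [lambda I - A] is diagonal ([lambda] on [Q], [lambda + 1] on the two missed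
    vertices) minus the all-ones matrix. The determinant of such a rank-one
    update factors as
    [lambda^(n-3) (lambda + 1) (lambda^2 - (n - 1) lambda - (n - 2))], and the
    two roots of the quadratic have opposite signs, so their absolute values
    add up to the square root of its discriminant [n^2 + 2 n - 7]. *)
Require Import Defs.
From mathcomp Require Import all_boot all_order all_algebra.
From mathcomp Require Import zify ring lra.

Import Order.TTheory GRing.Theory Num.Theory.
Local Open Scope ring_scope.

(** The matrix determinant lemma with denominators cleared, so that it applies over [{poly R}],
    where the entries of [d] need not be units. *)
Lemma det_diag_mx_add_rank1 (R : idomainType) (n : nat) (d : 'rV[R]_n)
    (u : 'cV[R]_n) (v : 'rV[R]_n) :
  (forall i, d 0 i != 0) ->
  \det (diag_mx d + u *m v)
    = \prod_i d 0 i + \sum_i v 0 i * u i 0 * \prod_(j | j != i) d 0 j.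
Proof.
move=> dN0; set P := \prod_i d 0 i.
have PN0 : P != 0 by apply/prodf_neq0 => i _.
pose E : 'cV[R]_n := \col_i (u i 0 * \prod_(j | j != i) d 0 j).
(* Eliminating [- u] from [M] by row or by column operations gives the two
   sides, up to the factor [P] that avoids dividing by [d]. *)
pose M := block_mx (1%:M : 'M_1) v (- u) (diag_mx d).
have detM : \det M = \det (diag_mx d + u *m v).
  have := det_mulmx (block_mx 1%:M 0 u 1%:M) M.
  rewrite /M mulmx_block !mul1mx !mulmx1 !mul0mx !addr0 subrr.
  by rewrite det_ublock det_lblock !det1 !mul1r addrC => ->.
have : M *m block_mx P%:M 0 E 1%:M
    = block_mx (P%:M + v *m E) v 0 (diag_mx d).
  rewrite /M mulmx_block !mul1mx !mulmx1 !mulmx0 !add0r.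
  congr (block_mx _ _ _ _); apply/matrixP => i j.
  rewrite mul_diag_mx mul_mx_scalar !mxE !ord1.
  (* The lower left block vanishes because [d 0 i * E i 0 = u i 0 * P]. *)
  by rewrite /P (bigD1 i) //=; ring.
move=> /(congr1 determinant).
(* The factor [P] comes from the scalar block on the left and from [diag_mx d] on the right, and
   cancels. *)
rewrite det_mulmx det_lblock det_ublock det1 mulr1 det_diag -/P det_scalar1.
rewrite det_mx11 detM => /(mulIf PN0) ->; rewrite !mxE mulr1n.
by congr (_ + _); apply: eq_bigr => i _; rewrite mxE mulrA.
Qed.

(** Any three distinct vertices of a complete graph form a path, so being a covering only forbids
    three vertices outside [Q]. *)
Lemma covering3_complete (n : nat) (Q : {set 'I_n}) :
  covering3 (complete_graph n) Q <-> (#|~: Q| <= 2)%N.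
Proof.
split=> [covQ | leQ u v w /and3P[/= uvw _ _]].
  rewrite leqNgt; apply/negP => /card_gt2P[u [v [w [[uQ vQ wQ] [uv vw wu]]]]].
  have : path3 (complete_graph n) u v w.
    rewrite /path3 /= !inE /complete_adj negb_or uv vw.
    by rewrite (eq_sym u w) wu.
  move=> /covQ; move: uQ vQ wQ; rewrite !inE.
  by move=> /negbTE-> /negbTE-> /negbTE->.
apply: contraTT leQ; rewrite !negb_or -ltnNge => /and3P[uQ vQ wQ].
move: uvw; rewrite !inE negb_or andbT => /andP[/andP[uv uw] vw].
by apply/card_gt2P; exists u, v, w; rewrite !inE (eq_sym w u).
Qed.

Lemma min_covering3_complete_card (n : nat) (Q : {set 'I_n}) :
  (2 <= n)%N -> min_covering3 (complete_graph n) Q -> #|~: Q| = 2.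
Proof.
move=> n2 [/covering3_complete leQ minQ]; apply/eqP; rewrite eqn_leq leQ /=.
have /card_gt1P[x [y [_ _ xy]]] : (1 < #|'I_n|)%N by rewrite card_ord.
(* The complement of any pair is a covering, so a minimum one leaves out at least two vertices. *)
have cardC : #|~: ~: [set x; y]| = 2 by rewrite setCK cards2 xy.
have /minQ : covering3 (complete_graph n) (~: [set x; y]).
  by apply/covering3_complete; rewrite cardC.
rewrite -(leq_add2r #|~: Q|) cardsC -(cardsC (~: [set x; y])) cardC.
by rewrite leq_add2l.
Qed.

(** Writing the order as [m.+3] keeps truncated subtraction out of the exponent and the
    coefficients. *)
Lemma char_poly_covering3_complete (R : rcfType) (m : nat)
    (Q : {set 'I_m.+3}) : #|~: Q| = 2 ->
  char_poly (covering3_mx R (complete_graph m.+3) Q)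
    = 'X^m * ('X + 1) * ('X ^+ 2 - m.+2%:R *: 'X - m.+1%:R%:P).
Proof.
move=> cardC.
have cardQ : #|Q| = m.+1 by have := cardsC Q; rewrite cardC card_ord; lia.
pose d : 'rV[{poly R}]_m.+3 := \row_i ('X + (i \notin Q)%:R).
have X1N0 : 'X + 1 != 0 :> {poly R} by rewrite -size_poly_eq0 size_XaddC.
have dN0 i : d 0 i != 0.
  by rewrite mxE; case: (i \in Q); rewrite //= addr0 polyX_eq0.
have prodd : \prod_i d 0 i = 'X^(m.+1) * ('X + 1) ^+ 2.
  transitivity ('X^#|Q| * ('X + 1) ^+ #|~: Q| : {poly R}); last first.
    by rewrite cardQ cardC.
  rewrite (bigID [in Q]) /= -!prodr_const.
  congr (_ * _); first by apply: eq_bigr => i iQ; rewrite mxE iQ addr0.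
  by apply: eq_big => i; rewrite ?inE // => iQ; rewrite mxE iQ.
(* Each product omitting one index is obtained by cancelling [d 0 i] from the full product. *)
have mulD i : d 0 i * \prod_(j | j != i) d 0 j = 'X^(m.+1) * ('X + 1) ^+ 2.
  by rewrite -prodd [RHS](bigD1 i).
have prodQ i : i \in Q -> \prod_(j | j != i) d 0 j = 'X^m * ('X + 1) ^+ 2.
  move=> iQ; apply: (mulfI (dN0 i)); rewrite mulD.
  by rewrite mxE iQ addr0 exprS; ring.
have prodC i : i \in ~: Q -> \prod_(j | j != i) d 0 j = 'X^(m.+1) * ('X + 1).
  rewrite inE => iQ; apply: (mulfI (dN0 i)).
  by rewrite mulD mxE iQ mulr1n exprS; ring.
have charE : char_poly_mx (covering3_mx R (complete_graph m.+3) Q)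
    = diag_mx d + const_mx (-1) *m (const_mx 1 : 'rV_m.+3).
  apply/matrixP => i j; rewrite !mxE big_ord1 !mxE /= /complete_adj.
  case: (eqVneq i j) => _ /=; last by rewrite !mulr0n !mulr1 polyC1.
  by case: (i \in Q); rewrite /= !mulr1n ?polyC1 ?polyC0; ring.
rewrite /char_poly charE det_diag_mx_add_rank1 // prodd.
under eq_bigr => i _ do rewrite !mxE mul1r mulN1r.
rewrite sumrN (bigID [in Q]) /= (eq_bigr _ prodQ) sumr_const cardQ.
rewrite (eq_bigl [in ~: Q]) => [|i]; last by rewrite !inE.
rewrite (eq_bigr _ prodC) sumr_const cardC.
(* Taking out ['X^m * ('X + 1)] leaves ['X * ('X + 1) - m.+1 * ('X + 1) - 2 * 'X], which is the
   quadratic factor. *)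
rewrite -mul_polyC !polyC_natr exprS; ring.
Qed.

Theorem mainTheorem1 (R : rcfType) (n : nat) (hn : (3 <= n)%N)
    (Q : {set 'I_n}) (hQ : min_covering3 (complete_graph n) Q) :
  covering3_energy R (complete_graph n) Q
    = 1 + Num.sqrt (n%:R ^+ 2 + 2 * n%:R - 7).
Proof.
have cardC := min_covering3_complete_card _ _ (ltnW hn) hQ.
case: n hn Q {hQ} cardC => [|[|[|m]]] // _ Q cardC.
set D := _ - 7; set s := Num.sqrt D.
have m_ge0 : 0 <= m%:R :> R by rewrite ler0n.
have DE : D = m.+2%:R ^+ 2 + 4 * m.+1%:R by rewrite /D -!natr1; ring.
have s2 : s ^+ 2 = D by rewrite sqr_sqrtr // DE -!natr1; nra.
(* This bound makes the smaller root [r2] nonpositive. *)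
have s_ge : m.+2%:R <= s.
  rewrite -[leLHS]ger0_norm ?ler0n // -sqrtr_sqr ler_wsqrtr // DE.
  by rewrite lerDl mulr_ge0 ?ler0n.
pose r1 := (m.+2%:R + s) / 2; pose r2 := (m.+2%:R - s) / 2.
have charE : char_poly (covering3_mx R (complete_graph m.+3) Q)
    = \prod_(x <- [:: -1; r1; r2] ++ nseq m 0) ('X - x%:P).
  rewrite char_poly_covering3_complete // big_cat !big_cons big_nil /=.
  rewrite big_nseq subr0 iter_mulr_1.
  have -> : 'X ^+ 2 - m.+2%:R *: 'X - m.+1%:R%:P
      = ('X - r1%:P) * ('X - r2%:P) :> {poly R}.
    have -> : m.+2%:R = r1 + r2 by rewrite /r1 /r2; field.
    have -> : m.+1%:R = - (r1 * r2).
      have -> : - (r1 * r2) = (s ^+ 2 - m.+2%:R ^+ 2) / 4.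
        by rewrite /r1 /r2; field.
      by rewrite s2 DE; field.
    by rewrite -mul_polyC polyCD polyCN (polyCM r1); ring.
  by rewrite polyCN polyC1; ring.
rewrite /covering3_energy -(perm_big _ (perm_eigenvalues charE)).
rewrite big_cat !big_cons big_nil big_nseq iter_addr_0 normr0 mul0rn /=.
have r1_ge0 : 0 <= r1 by rewrite /r1; have := ler0n R m.+2; lra.
have r2_le0 : r2 <= 0 by rewrite /r2; lra.
(* The zero eigenvalues contribute nothing, and the others give [1 + r1 - r2 = 1 + s]. *)
by rewrite normrN1 (ger0_norm r1_ge0) (ler0_norm r2_le0) /r1 /r2; field.
Qed.
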